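(* Fix $\theta>0$. For each positive integer $m$, if $\sigma$ is drawn from the Ewens measure $\mathbb{P}_{\theta,n}$ on $\mathfrak{S}_n$, then as $n\to\infty$, \[\mathbb{E}_{\theta,n}\big(\mathsf{invol}(\sigma)\,\big|\,K(\sigma)=m\big) = \frac{n^m}{m!\,\log^{m-1} n}\left(1 + O\!\left(\frac{1}{\log n}\right)\right).\]
   Context: For $\sigma\in\mathfrak{S}_n$, $\mathsf{invol}(\sigma)$ is the number of ordered pairs $(\tau_1,\tau_2)$ of involutions in $\mathfrak{S}_n$ with $\sigma=\tau_2\circ\tau_1$, and $K(\sigma)$ is the number of cycles of $\sigma$. For $\theta>0$, the Ewens measure on $\mathfrak{S}_n$ is $\mathbb{P}_{\theta,n}(\sigma=\sigma_0)=\theta^{K(\sigma_0)}/\theta^{(n)}$ with $\theta^{(n)}=\theta(\theta+1)\cdots(\theta+n-1)$. *)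

(* Defs.v *)
From HB Require Import structures.
From mathcomp Require Import all_boot all_order all_algebra all_fingroup.
From mathcomp Require Import all_classical all_reals all_analysis.
Set Implicit Arguments. Unset Strict Implicit. Unset Printing Implicit Defensive.
Import Order.TTheory GRing.Theory Num.Theory.
Local Open Scope ring_scope.

(* invol(s) = number of ordered pairs (t1,t2) of involutions (t^2 = id,
   the identity counts) with s = t2 o t1.  In mathcomp, (t1 * t2) x = t2 (t1 x),
   so t2 o t1 is the perm product t1 * t2. *)
Definition invol (n : nat) (s : {perm 'I_n}) : nat :=
  #|[set p : {perm 'I_n} * {perm 'I_n} |
      [&& (p.1 * p.1 == 1)%g, (p.2 * p.2 == 1)%g & s == (p.1 * p.2)%g]]|.

(* number of cycles (fixed points count as cycles) *)
Definition ncycles (n : nat) (s : {perm 'I_n}) : nat := #|porbits s|.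

Definition rising (R : realType) (theta : R) (n : nat) : R :=
  \prod_(i < n) (theta + i%:R).

Definition ewens (R : realType) (theta : R) (n : nat) (s : {perm 'I_n}) : R :=
  theta ^+ ncycles s / rising theta n.

Definition cond_invol (R : realType) (theta : R) (n m : nat) : R :=
  (\sum_(s : {perm 'I_n} | ncycles s == m) (invol s)%:R * @ewens R theta n s)
  / (\sum_(s : {perm 'I_n} | ncycles s == m) @ewens R theta n s).

Definition main_term (R : realType) (n m : nat) : R :=
  (n%:R) ^+ m / ((m`!)%:R * (ln (n%:R : R)) ^+ (m.-1)).

(* Main.v *)
Require Import Defs.
From HB Require Import structures.
From mathcomp Require Import all_boot all_order all_algebra all_fingroup.
From mathcomp Require Import all_classical all_reals all_analysis.
From mathcomp Require Import ring lra.
(* Re-imported because the classical library shadows names such as [eqEsubset]. *)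
From mathcomp Require Import fintype finset.
Import Order.TTheory GRing.Theory Num.Theory.
Set Implicit Arguments. Unset Strict Implicit. Unset Printing Implicit Defensive.
Local Open Scope ring_scope.

(* A factorisation s = t2 o t1 into involutions amounts to an involution t = t1
   inverting s, and t is determined by its values at one base point per cycle
   of s.  If t preserves every cycle these values are free, which gives the
   product W(s) of the cycle lengths; if t moves a cycle C, one factor |C| is
   lost.  Hence W(s) <= invol(s) <= W(s) + m^m V(s), where m is the number of
   cycles and V(s) = W(s) * sum_C 1/|C|.

   Under the Ewens measure conditioned on K = m all permutations are equally
   likely.  Inserting a new point into a permutation yields recurrences in n
   for the number of permutations with m cycles (Stirling numbers) and for the
   sums of W (Lah numbers, n!/m! * binomial (n-1) (m-1)) and of V, the latter
   being smaller than the former by a factor O(log n / n); the Stirling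
   recurrence gives (n-1)! log^(m-1) n / (m-1)! up to 1 + O(1/log n). *)

(** * Inserting a point into a permutation *)

(** The transposition acts last, so [ord0] goes to [k] and whatever was sent to [k] now goes to
    [ord0]: the new point is spliced in just before [k], or is a new fixed point when [k] is
    [ord0]. *)
Definition insert_point n (k : 'I_n.+1) (s : {perm 'I_n}) : {perm 'I_n.+1} :=
  (lift_perm ord0 ord0 s * tperm ord0 k)%g.

Lemma insert_point_inj n : injective (fun x : 'I_n.+1 * {perm 'I_n} => insert_point x.1 x.2).
Proof.
move=> [k s] [l t] /= e.
have ek : k = l.
  by move/permP: e => /(_ ord0); rewrite !permM !lift_perm_id !tpermL.
subst l; congr pair; move/mulIg: e => e.
apply/permP => i; move/permP: e => /(_ (lift ord0 i)).
by rewrite !lift_perm_lift => /lift_inj.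
Qed.

Lemma insert_point_bij n : bijective (fun x : 'I_n.+1 * {perm 'I_n} => insert_point x.1 x.2).
Proof.
apply: inj_card_bij (@insert_point_inj n) _.
by rewrite card_prod card_ord !card_Sn factS.
Qed.

(** The order of this list is an artefact of the enumeration, so it matters only up to [perm_eq]. *)
Definition cycle_sizes n (s : {perm 'I_n}) : seq nat :=
  map (fun C : {set 'I_n} => #|C|) (enum (porbits s)).

Lemma porbit_sub (T : finType) (s : {perm T}) (D : pred T) x :
  (forall y, D y -> D (s y)) -> D x -> forall y, y \in porbit s x -> D y.
Proof.
move=> Ds Dx y /porbitP[i ->]; elim: i => [|i IH]; first by rewrite perm1.
by rewrite expgSr permM; exact: Ds.
Qed.

Lemma porbit_step (T : finType) (s : {perm T}) x y :
  (s y \in porbit s x) = (y \in porbit s x).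
Proof. by rewrite -!eq_porbit_mem -(porbit_perm s 1 y) expg1. Qed.

Lemma porbits_insert_fixed n (s : {perm 'I_n}) :
  porbits (insert_point ord0 s) =
    [set ord0] |: [set lift ord0 @: (C : {set 'I_n}) | C in porbits s].
Proof.
set u := insert_point ord0 s.
have u0 : u ord0 = ord0 by rewrite permM lift_perm_id tperm1 perm1.
have ul i : u (lift ord0 i) = lift ord0 (s i).
  by rewrite permM lift_perm_lift tperm1 perm1.
have o0 : porbit u ord0 = [set ord0].
  apply/eqP; rewrite eqEsubset sub1set porbit_id andbT; apply/subsetP => y.
  by rewrite inE; apply: (@porbit_sub _ u (pred1 ord0)) => //= z /eqP->; rewrite u0.
have ol i : porbit u (lift ord0 i) = lift ord0 @: (porbit s i).
  apply/eqP; rewrite eqEsubset; apply/andP; split; apply/subsetP => y.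
    apply: (@porbit_sub _ u (mem (lift ord0 @: porbit s i))) => /= [z|].
      by case/imsetP => j ji ->; rewrite ul mem_imset ?porbit_step //; exact: lift_inj.
    by rewrite mem_imset ?porbit_id //; exact: lift_inj.
  case/imsetP => j /porbitP[k ->] ->; elim: k => [|k IH]; first by rewrite perm1 porbit_id.
  by rewrite expgSr permM -ul porbit_step.
apply/setP => A; rewrite !inE; apply/imsetP/orP.
  move=> [x _ ->]; case: (unliftP ord0 x) => [i|] ->.
    by right; rewrite ol; apply/imsetP; exists (porbit s i) => //; exact: imset_f.
  by left; rewrite o0.
case => [/eqP->|/imsetP[C /imsetP[i _ ->] ->]]; first by exists ord0.
by exists (lift ord0 i); rewrite ?ol.
Qed.

Lemma perm_enum_setU1 (T : finType) (x : T) (A : {set T}) :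
  x \notin A -> perm_eq (enum (x |: A)) (x :: enum A).
Proof.
move=> xA; apply: uniq_perm; rewrite /= ?enum_uniq ?mem_enum ?xA //.
by move=> y; rewrite inE !mem_enum !inE.
Qed.

Lemma perm_enum_imset (T U : finType) (f : T -> U) (A : {set T}) :
  {in A &, injective f} -> perm_eq (enum (f @: A)) (map f (enum A)).
Proof.
move=> fI; apply: uniq_perm; rewrite ?enum_uniq //.
  by rewrite map_inj_in_uniq ?enum_uniq // => x y; rewrite !mem_enum; exact: fI.
move=> y; rewrite mem_enum; apply/imsetP/mapP => -[x xA ->]; exists x => //.
  by rewrite mem_enum.
by rewrite mem_enum in xA.
Qed.

Lemma cycle_sizes_insert_fixed n (s : {perm 'I_n}) :
  perm_eq (cycle_sizes (insert_point ord0 s)) (1%N :: cycle_sizes s).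
Proof.
rewrite /cycle_sizes porbits_insert_fixed.
set Q := [set _ | _ in _].
have l0 : [set ord0] \notin Q.
  apply/imsetP => -[C _] /setP/(_ ord0); rewrite inE eqxx.
  by move=> /esym/imsetP[i _] /eqP; rewrite (negPf (neq_lift _ _)).
apply: perm_trans (perm_map _ (perm_enum_setU1 l0)) _.
rewrite /= cards1 perm_cons.
apply: perm_trans (perm_map _ (perm_enum_imset _)) _.
  by move=> A B _ _; apply: imset_inj; exact: lift_inj.
rewrite -map_comp perm_sym; apply/seq.permP => a; congr (seq.count _ _); apply: eq_map => A /=.
by rewrite card_imset //; exact: lift_inj.
Qed.

(** The map [p] collapses the new point onto its successor [j]. Each new cycle is then a full
    preimage of an old one, and only the cycle of [j] grows. *)
Lemma porbits_insert_point n (s : {perm 'I_n}) (j : 'I_n) :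
  let p i := if unlift ord0 i is Some i' then i' else j in
  porbits (insert_point (lift ord0 j) s) = [set p @^-1: (C : {set 'I_n}) | C in porbits s].
Proof.
move=> p; set u := insert_point _ s.
have p0 : p ord0 = j by rewrite /p unlift_none.
have pl i : p (lift ord0 i) = i by rewrite /p liftK.
have u0 : u ord0 = lift ord0 j by rewrite permM lift_perm_id tpermL.
have ul i : u (lift ord0 i) = if s i == j then ord0 else lift ord0 (s i).
  rewrite permM lift_perm_lift; case: eqP => [->|/eqP ne]; first by rewrite tpermR.
  by rewrite tpermD // ?(inj_eq (@lift_inj _ _)) 1?eq_sym // neq_lift.
(* A step of [s] arriving at [j] becomes two steps of [u], through [ord0]; the other steps lift
   unchanged. *)
have step i y : y \in porbit s i -> lift ord0 y \in porbit u (lift ord0 i).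
  case/porbitP => k ->; elim: k => [|k IH]; first by rewrite perm1 porbit_id.
  rewrite expgSr permM; move: ((s ^+ k)%g i) IH => z IH.
  have := ul z; case: eqP => [->|_] uz; last by rewrite -uz porbit_step.
  by rewrite -porbit_step uz in IH; rewrite -u0 porbit_step.
have lp x y : (lift ord0 (p y) \in porbit u x) = (y \in porbit u x).
  by case: (unliftP ord0 y) => [i|] ->; rewrite ?pl // p0 -u0 porbit_step.
have o x : porbit u x = p @^-1: porbit s (p x).
  apply/eqP; rewrite eqEsubset; apply/andP; split; apply/subsetP => y.
    apply: (@porbit_sub _ u (mem (p @^-1: porbit s (p x)))) => /= [z|]; rewrite !inE ?porbit_id //.
    case: (unliftP ord0 z) => [i|] ->; last by rewrite u0 pl p0.
    by rewrite ul pl; case: eqP => [e|_]; rewrite ?p0 -?e ?pl porbit_step.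
  by rewrite inE => /step h; rewrite lp porbit_sym lp in h; rewrite porbit_sym.
apply/setP => A; apply/imsetP/imsetP.
  by move=> [x _ ->]; exists (porbit s (p x)); rewrite ?imset_f.
by move=> [C /imsetP[i _ ->] ->]; exists (lift ord0 i); rewrite // o pl.
Qed.

Lemma cycle_sizes_insert_point n (s : {perm 'I_n}) (j : 'I_n) :
  perm_eq (cycle_sizes (insert_point (lift ord0 j) s))
          (#|porbit s j|.+1 :: rem #|porbit s j| (cycle_sizes s)).
Proof.
set k := #|_|; rewrite /cycle_sizes porbits_insert_point.
set p := fun i : 'I_n.+1 => _.
have p0 : p ord0 = j by rewrite /p unlift_none.
have pl i : p (lift ord0 i) = i by rewrite /p liftK.
(* The fibre of [p] over [j] has two points, all other fibres have one. *)
have cp (A : {set 'I_n}) : #|p @^-1: A| = ((j \in A) + #|A|)%N.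
  have -> : p @^-1: A = (if j \in A then [set ord0] else set0) :|: lift ord0 @: A.
    apply/setP => i; rewrite !inE; case: (unliftP ord0 i) => [i'|] ->.
      rewrite pl mem_imset; last exact: lift_inj.
      by case: ifP; rewrite !inE // eq_sym (negPf (neq_lift _ _)).
    rewrite p0; set b := (X in _ = _ || X).
    have -> : b = false.
      by apply/negbTE/imsetP => -[x _] /eqP; rewrite (negPf (neq_lift _ _)).
    by case: ifP; rewrite inE ?eqxx.
  rewrite cardsU card_imset; last exact: lift_inj.
  have -> : (if j \in A then [set ord0] else set0) :&: lift ord0 @: A = set0.
    apply/setP => i; rewrite !inE; apply/negbTE/andP => -[h /imsetP[x _ e]]; subst i.
    by move: h; case: ifP; rewrite !inE // eq_sym (negPf (neq_lift _ _)).
  by rewrite cards0 subn0; case: ifP; rewrite ?cards1 ?cards0.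
apply: perm_trans (perm_map _ (perm_enum_imset _)) _.
  move=> A B _ _ /setP e; apply/setP => i; have := e (lift ord0 i).
  by rewrite !inE pl.
rewrite -map_comp (eq_map (g := fun C : {set 'I_n} => ((j \in C) + #|C|)%N) cp).
have Pj : porbit s j \in porbits s by exact: imset_f.
have e : perm_eq (enum (porbits s)) (porbit s j :: enum (porbits s :\ porbit s j)).
  by rewrite -{1}(setD1K Pj); apply: perm_enum_setU1; rewrite !inE eqxx.
apply: perm_trans (perm_map _ e) _.
rewrite /= porbit_id perm_cons.
have -> : map (fun C : {set 'I_n} => ((j \in C) + #|C|)%N)
             (enum (porbits s :\ porbit s j)) =
          map (fun C : {set 'I_n} => #|C|) (enum (porbits s :\ porbit s j)).
  apply/eq_in_map => C; rewrite mem_enum !inE => /andP[ne /imsetP[x _ eC]].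
  by rewrite eC -eq_porbit_mem eq_sym -eC (negPf ne).
rewrite -(perm_cons k); apply: perm_trans (perm_to_rem _); last first.
  by apply/mapP; exists (porbit s j); rewrite ?mem_enum.
by rewrite perm_sym; exact: (perm_map (fun C : {set 'I_n} => #|C|) e).
Qed.

(** By bijectivity of insertion, each larger permutation arises once. A cycle of length [k] offers
    [k] places for the new point, hence the multiplicity [*+ k]. *)
Lemma sum_insertion (R : nmodType) (F : seq nat -> R) :
  (forall l l', perm_eq l l' -> F l = F l') -> forall n : nat,
  \sum_(s : {perm 'I_n.+1}) F (cycle_sizes s) =
  \sum_(s : {perm 'I_n}) (F (1%N :: cycle_sizes s) +
     \sum_(k <- cycle_sizes s) F (k.+1 :: rem k (cycle_sizes s)) *+ k).
Proof.
move=> FP n.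
rewrite (reindex _ (onW_bij _ (@insert_point_bij n))) /=.
rewrite -(pair_big xpredT xpredT (fun k s => F (cycle_sizes (insert_point k s)))) /=.
rewrite exchange_big /=; apply: eq_bigr => s _.
rewrite big_ord_recl (FP _ _ (cycle_sizes_insert_fixed s)); congr (_ + _).
rewrite (eq_bigr (fun j => F (#|porbit s j|.+1 :: rem #|porbit s j| (cycle_sizes s)))); last first.
  by move=> j _; exact/FP/cycle_sizes_insert_point.
rewrite big_map big_enum /= (partition_big_imset (porbit s)) /=.
apply: eq_bigr => C /imsetP[x _ ->].
rewrite (eq_bigr (fun=> F (#|porbit s x|.+1 :: rem #|porbit s x| (cycle_sizes s)))); last first.
  by move=> j /eqP->.
by rewrite sumr_const; congr (_ *+ _); apply: eq_card => y; exact: eq_porbit_mem.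
Qed.

(** * Involutions inverting a permutation *)

Section Reversals.
Variables (T : finType) (s : {perm T}).
Implicit Types (t u : {perm T}) (x y z : T) (C : {set T}).

(** An element [t] stands for the factorisation with first factor [t] and second factor [t * s]. *)
Definition reversals : {set {perm T}} :=
  [set t : {perm T} | (t * t == 1)%g & (t * s * (t * s) == 1)%g].

Lemma reversalP t :
  reflect ((forall x, t (t x) = x) /\ (forall x, t (s x) = s^-1%g (t x)))
          (t \in reversals).
Proof.
rewrite inE; apply: (iffP andP) => [[/eqP/permP tt /eqP/permP sts]|[tt ts]].
  have tK x : t (t x) = x by have := tt x; rewrite permM perm1.
  split=> // x; have := sts (t x); rewrite !permM perm1 tK => e.
  by rewrite -[in RHS]e permK.
split; apply/eqP/permP => x; rewrite !permM perm1 //.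
by rewrite ts permKV.
Qed.

Lemma reversal_pow t x i : t \in reversals -> t ((s ^+ i)%g x) = (s ^- i)%g (t x).
Proof.
move=> /reversalP[_ ts]; elim: i => [|i IH]; first by rewrite invg1 !perm1.
by rewrite expgSr permM ts IH -permM -invMg -expgS expgSr.
Qed.

Lemma mem_porbitN x i : (s ^- i)%g x \in porbit s x.
Proof. by rewrite -porbitV -expgVn mem_porbit. Qed.

Lemma reversal_porbit t x y : t \in reversals ->
  y \in porbit s x -> t y \in porbit s (t x).
Proof.
by move=> tR /porbitP[i ->]; rewrite (reversal_pow _ _ tR) mem_porbitN.
Qed.

Lemma eq_on_porbit t u x y : t \in reversals -> u \in reversals ->
  t x = u x -> y \in porbit s x -> t y = u y.
Proof. by move=> tR uR e /porbitP[i ->]; rewrite !reversal_pow // e. Qed.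

Variable x0 : T.

(** The default [x0] is reached only for the empty set, which is not a cycle. *)
Definition base (C : {set T}) : T := odflt x0 [pick y in C].

Lemma base_in C : C \in porbits s -> base C \in C.
Proof.
case/imsetP => x _ ->; rewrite /base; case: pickP => //= /(_ x).
by rewrite porbit_id.
Qed.

Lemma porbit_base C : C \in porbits s -> porbit s (base C) = C.
Proof.
move=> CP; have := base_in CP; case/imsetP: CP => x _ -> h.
by apply/eqP; rewrite eq_porbit_mem.
Qed.

Lemma mem_porbits x : porbit s x \in porbits s. Proof. exact: imset_f. Qed.

Lemma reversal_ext t u : t \in reversals -> u \in reversals ->
  {in porbits s, forall C, t (base C) = u (base C)} -> t = u.
Proof.
move=> tR uR e; apply/permP => x; apply: eq_on_porbit (e _ (mem_porbits x)) _ => //.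
by rewrite porbit_base ?mem_porbits ?porbit_id.
Qed.

(** Powers of [s] commute, so two powers that agree at one point of a cycle agree on all of it, and
    so do their inverses. This makes constructions independent of the exponent chosen to reach a
    point. *)
Lemma pow_porbit_eq x y z i j : y \in porbit s x -> z \in porbit s x ->
  (s ^+ i)%g y = (s ^+ j)%g y -> (s ^- i)%g z = (s ^- j)%g z.
Proof.
move=> yx zx e.
have E w : w \in porbit s x -> (s ^+ i)%g w = (s ^+ j)%g w.
  have -> : porbit s x = porbit s y by apply/eqP; rewrite eq_sym eq_porbit_mem.
  case/porbitP => d ->; rewrite -!permM.
  by rewrite -!expgD addnC [(d + j)%N]addnC !expgD !permM e.
have zi : (s ^- i)%g z \in porbit s x.
  have -> : porbit s x = porbit s z by apply/eqP; rewrite eq_sym eq_porbit_mem.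
  exact: mem_porbitN.
by apply: (@perm_inj _ (s ^+ j)%g); rewrite -(E _ zi) !permKV.
Qed.

Definition preserving : {set {perm T}} :=
  [set t in reversals | [forall x, t x \in porbit s x]].

(** Sets that are not cycles receive [x0], as membership in [pfamily x0] demands. *)
Definition base_values (t : {perm T}) : {ffun {set T} -> T} :=
  [ffun C => if C \in porbits s then t (base C) else x0].

Lemma base_values_surj (f : {ffun {set T} -> T}) :
  f \in pfamily x0 (mem (porbits s)) (fun C : {set T} => mem C) ->
  exists2 t, t \in reversals & base_values t = f.
Proof.
move=> /pfamilyP[/supportP f0 fC].
have fin x : f (porbit s x) \in porbit s x by apply: fC; exact: mem_porbits.
pose b x := base (porbit s x).
have bin x : b x \in porbit s x by apply: base_in (mem_porbits _).
have /fin_all_exists[k kP] x : exists k, x = (s ^+ k)%g (b x).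
  by apply/porbitP; rewrite porbit_sym.
(* This extension is forced: a point [k x] steps after its base point must go [k x] steps before the
   prescribed value. *)
pose t x := (s ^- k x)%g (f (porbit s x)).
have ts x : t (s x) = s^-1%g (t x).
  rewrite /t -permM -invMg -expgS.
  have es : porbit s (s x) = porbit s x.
    by apply/eqP; rewrite eq_porbit_mem porbit_step porbit_id.
  have eb : b (s x) = b x by rewrite /b es.
  (* The exponents [k (s x)] and [(k x).+1] may differ, but both carry the base point to [s x]. *)
  rewrite es; apply: (@pow_porbit_eq x (b x)) => //.
  by rewrite -eb -kP eb expgSr permM -kP.
have ts' x : t (s^-1%g x) = s (t x).
  by rewrite -{2}[x](permKV s) ts permKV.
have tp i x : t ((s ^- i)%g x) = (s ^+ i)%g (t x).
  elim: i => [|i IH]; first by rewrite invg1 !perm1.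
  by rewrite expgS invMg permM ts' IH -permM -expgSr expgS.
have tin x : t x \in porbit s x.
  have -> : porbit s x = porbit s (f (porbit s x)).
    by apply/eqP; rewrite eq_sym eq_porbit_mem fin.
  exact: mem_porbitN.
have same x y : y \in porbit s x -> porbit s y = porbit s x.
  by move=> h; apply/eqP; rewrite eq_porbit_mem.
have tK : involutive t.
  (* Since [x] is [k x] steps after its base point, it suffices that [t] sends the prescribed value
     back to that base point. *)
  move=> x; rewrite {2}/t tp [RHS]kP; congr ((s ^+ _)%g _).
  set y := f _; have yx : y \in porbit s x by exact: fin.
  rewrite /t (same _ _ yx) -/y {2}[y]kP permK /b.
  by rewrite (same _ _ yx).
have pt := permE (inv_inj tK); set u := perm _ in pt.
exists u; first by apply/reversalP; split=> x; rewrite !pt.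
apply/ffunP => C; rewrite ffunE; case: ifP => [CP|CP]; last first.
  by rewrite f0 ?CP.
rewrite pt /t (porbit_base CP).
(* The exponent chosen for [base C] itself need not be [0], so the two are compared on the cycle. *)
have {2}-> : f C = (s ^- 0)%g (f C) by rewrite invg1 perm1.
apply: (@pow_porbit_eq (base C) (base C)); rewrite ?porbit_id ?porbit_base ?fC //.
by rewrite expg0 perm1 {3}[base C]kP /b porbit_base.
Qed.

Lemma card_base_family :
  #|pfamily x0 (mem (porbits s)) (fun C : {set T} => mem C)| =
  (\prod_(C in porbits s) #|C|)%N.
Proof. by rewrite card_pfamily foldrE big_map big_enum. Qed.

Lemma card_reversals_ge : (\prod_(C in porbits s) #|C| <= #|reversals|)%N.
Proof.
rewrite -card_base_family; apply: leq_trans (leq_imset_card base_values _).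
apply: subset_leq_card; apply/subsetP => f /base_values_surj[t tR <-].
exact: imset_f.
Qed.

Lemma card_preserving_le : (#|preserving| <= \prod_(C in porbits s) #|C|)%N.
Proof.
rewrite -card_base_family -(card_in_imset (f := base_values)).
  apply: subset_leq_card; apply/subsetP => _ /imsetP[t + ->].
  rewrite inE => /andP[_ /forallP tx]; apply/pfamilyP; split.
    by apply/supportP => C CP; rewrite ffunE (negPf CP).
  by move=> C CP; rewrite ffunE CP -{2}(porbit_base CP).
move=> t u; rewrite in_set => /andP[tR _]; rewrite in_set => /andP[uR _] /ffunP e.
by apply: reversal_ext => // C CP; have := e C; rewrite !ffunE CP.
Qed.

(** * Reversals that move a given cycle *)

Section Moved.
Variable C0 : {set T}.
Hypothesis C0P : C0 \in porbits s.

Definition moving : {set {perm T}} := [set t in reversals | t (base C0) \notin C0].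

Definition orbit_map (t : {perm T}) : {ffun {set T} -> {set T}} :=
  [ffun C => if C \in porbits s then porbit s (t (base C)) else set0].

(** Indexing by the image cycle places the value recorded at [C] inside [C], so leaving out [C0]
    saves exactly the factor [#|C0|]. *)
Definition cobase_values (t : {perm T}) : {ffun {set T} -> T} :=
  [ffun C => if C \in porbits s :\ C0 then t (base (orbit_map t C)) else x0].

Lemma orbit_map_in t C : C \in porbits s -> orbit_map t C \in porbits s.
Proof. by move=> CP; rewrite ffunE CP mem_porbits. Qed.

Lemma cobase_in t C : t \in reversals -> C \in porbits s ->
  t (base (orbit_map t C)) \in C.
Proof.
move=> tR CP; have [tK _] := reversalP _ tR.
rewrite -{2}(porbit_base CP) -{1}(tK (base C)).
apply: reversal_porbit => //; rewrite ffunE CP.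
by rewrite base_in ?mem_porbits.
Qed.

Lemma orbit_mapK t C : t \in reversals -> C \in porbits s ->
  orbit_map t (orbit_map t C) = C.
Proof.
move=> tR CP; rewrite [LHS]ffunE orbit_map_in //.
rewrite -[RHS](porbit_base CP); apply/eqP; rewrite eq_porbit_mem porbit_base //.
exact: cobase_in.
Qed.

(** The pair of [orbit_map t] and [cobase_values t] determines [t]. The only value not recorded is
    the one at the base point of the cycle [D] exchanged with [C0]. As [D] differs from [C0], the
    value at [base C0] is known; it fixes [t] on [C0], hence on [D] because [t] is an involution.
    The power counts the possible maps on cycles. *)
Lemma card_moving_le :
  (#|moving| <= #|porbits s| ^ #|porbits s| * \prod_(C in porbits s :\ C0) #|C|)%N.
Proof.
pose F := pffun_on set0 (mem (porbits s)) (mem (porbits s)).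
pose G := pfamily x0 (mem (porbits s :\ C0)) (fun C : {set T} => mem C).
have cG : #|G| = (\prod_(C in porbits s :\ C0) #|C|)%N.
  by rewrite card_pfamily foldrE big_map big_enum.
rewrite -cG -(card_pffun_on set0) -/F -[#|F|]cardsE -[#|G|]cardsE -cardsX.
rewrite -(card_in_imset (f := fun t => (orbit_map t, cobase_values t))).
  apply: subset_leq_card; apply/subsetP => _ /imsetP[t + ->].
  rewrite in_set => /andP[tR _]; rewrite in_setX !in_set /=; apply/andP; split.
    apply/pfamilyP; split=> [|C CP]; last exact: orbit_map_in.
    by apply/supportP => C CP; rewrite ffunE (negPf CP).
  apply/pfamilyP; split=> [|C CP].
    by apply/supportP => C CP; rewrite ffunE (negPf CP).
  rewrite ffunE CP cobase_in //; by move: CP; rewrite !inE => /andP[].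
move=> t u; rewrite in_set => /andP[tR t0]; rewrite in_set => /andP[uR _] [ep eg].
have tK := (reversalP _ tR).1; have uK := (reversalP _ uR).1.
have E C : C \in porbits s -> orbit_map t C != C0 -> t (base C) = u (base C).
  move=> CP ne; move/ffunP: eg => /(_ (orbit_map t C)).
  have h : orbit_map t C \in porbits s :\ C0 by rewrite in_setD1 ne orbit_map_in.
  by rewrite [LHS]ffunE [RHS]ffunE h -ep orbit_mapK.
have e0 : t (base C0) = u (base C0).
  apply: E => //; apply: contra t0 => /eqP; rewrite ffunE C0P => e.
  by rewrite -{2}e porbit_id.
apply: reversal_ext => // C CP.
have [eC|] := eqVneq (orbit_map t C) C0; last exact: E.
set z := t (base C).
have zC : z \in porbit s (base C0).
  by rewrite porbit_base // -eC ffunE CP porbit_id.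
have : u z = base C by rewrite -(eq_on_porbit tR uR e0 zC) tK.
by move=> <-; rewrite uK.
Qed.

End Moved.

Lemma card_reversals_le :
  (#|reversals| <= \prod_(C in porbits s) #|C| +
    \sum_(C0 in porbits s)
      #|porbits s| ^ #|porbits s| * \prod_(C in porbits s :\ C0) #|C|)%N.
Proof.
have sub : reversals \subset preserving :|: \bigcup_(C in porbits s) moving C.
  apply/subsetP => t tR; rewrite in_setU in_set tR /=.
  have [/forallP|] := boolP [forall x, t x \in porbit s x]; first by [].
  rewrite negb_forall => /existsP[x tx]; apply/bigcupP.
  exists (porbit s x); rewrite ?mem_porbits // in_set tR.
  (* If [t] kept the base point in its cycle, it would keep every point of that cycle there. *)
  apply: contra tx => h.
  have xb : x \in porbit s (base (porbit s x)) by rewrite porbit_base ?mem_porbits ?porbit_id.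
  have := reversal_porbit tR xb.
  suff -> : porbit s (t (base (porbit s x))) = porbit s x by [].
  by apply/eqP; rewrite eq_porbit_mem.
apply: leq_trans (subset_leq_card sub) _.
apply: leq_trans (leq_card_setU _ _) _; apply: leq_add card_preserving_le _.
apply: leq_trans (_ : \sum_(C in porbits s) #|moving C| <= _)%N.
  elim/big_rec2: _ => [|C k A _ IH]; first by rewrite cards0.
  by apply: leq_trans (leq_card_setU _ _) _; rewrite leq_add2l.
by apply: leq_sum => C CP; exact: card_moving_le.
Qed.

End Reversals.

(** * Sums over permutations with a given number of cycles *)

Lemma sumn_cycle_sizes n (s : {perm 'I_n}) : sumn (cycle_sizes s) = n.
Proof.
rewrite sumnE big_map big_enum /=; apply: esym.
rewrite -[LHS]card_ord -sum1_card (partition_big_imset (porbit s)) /=.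
apply: eq_bigr => C /imsetP[x _ ->]; rewrite sum1_card; apply: eq_card => y.
exact: eq_porbit_mem.
Qed.

Lemma cycle_sizes_gt0 n (s : {perm 'I_n}) : all (ltn 0) (cycle_sizes s).
Proof.
apply/allP => k /mapP[C]; rewrite mem_enum => /imsetP[x _ ->] ->.
by rewrite /= lt0n card_porbit_neq0.
Qed.

Section CycleSums.
Variable R : realFieldType.
Implicit Types (f g : seq nat -> R) (l : seq nat) (m n p : nat).

Definition cycle_sum f n m : R :=
  \sum_(s : {perm 'I_n} | size (cycle_sizes s) == m) f (cycle_sizes s).

Lemma eq_cycle_sum f g n m :
  (forall l, size l = m -> sumn l = n -> all (ltn 0) l -> f l = g l) ->
  cycle_sum f n m = cycle_sum g n m.
Proof.
move=> e; apply: eq_bigr => s /eqP sm.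
by apply: e; rewrite ?sumn_cycle_sizes ?cycle_sizes_gt0.
Qed.

Lemma cycle_sumZ a f n m :
  cycle_sum (fun l => a * f l) n m = a * cycle_sum f n m.
Proof. by rewrite [RHS]mulr_sumr. Qed.

Lemma cycle_sumD f g n m :
  cycle_sum (fun l => f l + g l) n m = cycle_sum f n m + cycle_sum g n m.
Proof. exact: big_split. Qed.

Lemma cycle_sum0 f n : cycle_sum f n.+1 0 = 0.
Proof.
apply: big1 => s /nilP e; have := sumn_cycle_sizes s.
by rewrite e.
Qed.

Lemma cycle_sum_nil f m : cycle_sum f 0 m = (m == 0%N)%:R * f [::].
Proof.
have e (s : {perm 'I_0}) : cycle_sizes s = [::].
  have := sumn_cycle_sizes s; have := cycle_sizes_gt0 s.
  by case: (cycle_sizes s) => //= -[].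
rewrite /cycle_sum (eq_bigl (fun=> m == 0%N)); last by move=> s; rewrite e eq_sym.
case: eqP => _; last by rewrite big_pred0 ?mul0r.
rewrite (eq_bigr (fun=> f [::])); last by move=> s _; rewrite e.
by rewrite sumr_const card_Sn mul1r.
Qed.

Definition perm_invariant f := forall l l', perm_eq l l' -> f l = f l'.

(** A new fixed point adds a cycle, while lengthening a cycle keeps their number; [sum_insertion] is
    applied to [f] cut off to lists of length [m.+1]. *)
Lemma cycle_sumS f n m : perm_invariant f ->
  cycle_sum f n.+1 m.+1 = cycle_sum (fun l => f (1%N :: l)) n m +
    cycle_sum (fun l => \sum_(k <- l) f (k.+1 :: rem k l) *+ k) n m.+1.
Proof.
move=> fP; rewrite /cycle_sum big_mkcond /=.
rewrite (sum_insertion (F := fun l => if size l == m.+1 then f l else 0)); last first.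
  by move=> l l' e; rewrite (perm_size e) (fP _ _ e).
rewrite big_split /= [X in _ = X + _]big_mkcond [X in _ = _ + X]big_mkcond /=.
congr (_ + _); apply: eq_bigr => s _; set l := cycle_sizes s.
rewrite (eq_big_seq (fun k => if size l == m.+1 then f (k.+1 :: rem k l) *+ k else 0)).
  by case: ifP => // _; rewrite big1.
move=> k kl /=; rewrite size_rem //.
have -> : (size l).-1.+1 = size l by case: (l) kl.
by case: ifP; rewrite ?mul0rn.
Qed.

Definition stirling n m := cycle_sum (fun=> 1) n m.

Lemma stirlingS n m : stirling n.+1 m.+1 = stirling n m + n%:R * stirling n m.+1.
Proof.
rewrite /stirling cycle_sumS //; congr (_ + _).
rewrite -cycle_sumZ; apply: eq_cycle_sum => l _ <- _.
by rewrite mulr1 sumnE natr_sum.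
Qed.

Definition wprod l : R := \prod_(k <- l) k%:R.
(* For nonzero entries, the sum over the entries of the product of the others. *)
Definition vprod l : R := wprod l * \sum_(k <- l) k%:R^-1.

Lemma wprodP : perm_invariant wprod. Proof. by move=> l l' e; exact: perm_big. Qed.
Lemma vprodP : perm_invariant vprod.
Proof. by move=> l l' e; rewrite /vprod (wprodP e) (perm_big _ e). Qed.

Lemma wprod_cons k l : wprod (k :: l) = k%:R * wprod l.
Proof. by rewrite /wprod big_cons. Qed.

Lemma sum_size l : \sum_(k <- l) (k%:R + 1) = (sumn l + size l)%:R :> R.
Proof.
by rewrite big_split /= -natr_sum -sumnE natrD big_const_seq count_predT iter_addr addr0.
Qed.

(** Lengthening a cycle of length k multiplies the product by (k+1)/k and can be done in k ways, for
    a total weight k+1. Summed over the cycles this is [n + m.+1]. *)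
Lemma cycle_sum_wprodS n m :
  cycle_sum wprod n.+1 m.+1 =
  (n + m.+1)%:R * cycle_sum wprod n m.+1 + cycle_sum wprod n m.
Proof.
rewrite cycle_sumS; last exact: wprodP.
rewrite addrC; congr (_ + _); last first.
  by apply: eq_cycle_sum => l _ _ _; rewrite wprod_cons mul1r.
rewrite -cycle_sumZ; apply: eq_cycle_sum => l lm ln _.
rewrite -{1}ln -lm -sum_size mulr_suml; apply: eq_big_seq => k kl.
rewrite wprod_cons (wprodP (perm_to_rem kl)) wprod_cons.
by rewrite -mulr_natr -natr1; ring.
Qed.

(** Lengthening a cycle of length k contributes (k+1)V - W/k. The terms W/k sum to V, which lowers
    the coefficient by one compared with [cycle_sum_wprodS]. A new fixed point contributes V + W. *)
Lemma cycle_sum_vprodS n m :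
  cycle_sum vprod n.+1 m.+1 = (n + m)%:R * cycle_sum vprod n m.+1 +
    cycle_sum vprod n m + cycle_sum wprod n m.
Proof.
rewrite cycle_sumS; last exact: vprodP.
rewrite addrC -addrA; congr (_ + _); last first.
  rewrite -cycle_sumD; apply: eq_cycle_sum => l _ _ _ /=.
  by rewrite /vprod wprod_cons big_cons invr1; ring.
rewrite -cycle_sumZ; apply: eq_cycle_sum => l lm ln lp.
have -> : (n + m)%:R * vprod l = \sum_(k <- l) ((k%:R + 1) * vprod l - wprod l * k%:R^-1).
  rewrite big_split /= -mulr_suml sum_size lm ln sumrN -mulr_sumr -/(vprod l).
  by rewrite addnS -natr1; ring.
apply: eq_big_seq => k kl.
have k0 : k%:R != 0 :> R by rewrite pnatr_eq0 -lt0n; exact: (allP lp).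
have e := perm_to_rem kl.
rewrite (vprodP e) (wprodP e) /vprod !wprod_cons !big_cons.
rewrite -[LHS]mulr_natr -natr1.
have k1 : k%:R + 1 != 0 :> R by rewrite natr1 pnatr_eq0.
by field; rewrite k0 k1.
Qed.

Lemma cycle_sum_wprod n p :
  cycle_sum wprod n.+1 p.+1 * (p.+1)`!%:R = (n.+1)`!%:R * 'C(n, p)%:R.
Proof.
elim: n p => [|n IH] p.
  rewrite cycle_sum_wprodS !cycle_sum_nil /= mul0r mulr0 add0r.
  by case: p => [|p]; rewrite /= ?mul0r ?mulr0 // /wprod big_nil !mulr1.
rewrite cycle_sum_wprodS; case: p => [|p].
  rewrite cycle_sum0 addr0 -mulrA IH !bin0 !mulr1 factS natrM.
  by rewrite addn1 !factS !natrM.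
(* The subtraction is in the field; for p > n both binomials vanish. *)
have key : p.+1%:R * 'C(n, p.+1)%:R = (n%:R - p%:R) * 'C(n, p)%:R :> R.
  have [pn|np] := leqP p n; first by rewrite -natrB // -!natrM mul_bin_left.
  by rewrite !bin_small ?mulr0 // ltnW.
have fS k : k.+2`!%:R = (k%:R + 1 + 1) * (k.+1)`!%:R :> R by rewrite factS natrM -!natr1.
have := IH p.+1; have := IH p; rewrite binS !fS.
set Y := cycle_sum _ _ _; set X := cycle_sum _ _ _.
move: (_`!%:R) (_`!%:R) => F G.
move: key; rewrite !natrD -!natr1 => key.
move: ('C(_, _)%:R) ('C(_, _)%:R) key => c0 c1 key B A.
have -> a b : (a * X + Y) * b = a * (X * b) + b * Y by ring.
rewrite A.
transitivity ((n%:R + p%:R + 1 + 1 + 1) * (F * c1) + (p%:R + 1 + 1) * (Y * G)).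
  by ring.
rewrite B; transitivity (F * ((n%:R + 1 + 1) * (c1 + c0) + ((p%:R + 1) * c1 - (n%:R - p%:R) * c0))).
  by ring.
by rewrite key; ring.
Qed.

End CycleSums.

(** * Estimates *)

Section Bounds.
Variable R : realFieldType.
Implicit Types (x d h : R) (n p : nat).

Definition harm n : R := \sum_(i < n) i.+1%:R^-1.

Lemma harmS n : harm n.+1 = harm n + n.+1%:R^-1.
Proof. exact: big_ord_recr. Qed.

Lemma harm_ge0 n : 0 <= harm n.
Proof. by apply: sumr_ge0 => i _; rewrite invr_ge0. Qed.

Lemma exprD_ge x d p : 0 <= x -> 0 <= d ->
  x ^+ p.+1 + p.+1%:R * x ^+ p * d <= (x + d) ^+ p.+1.
Proof.
move=> x0 d0; elim: p => [|p IH]; first by rewrite expr0 !expr1; lra.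
rewrite [leRHS]exprS.
apply: le_trans (_ : (x + d) * (x ^+ p.+1 + p.+1%:R * x ^+ p * d) <= _); last first.
  by rewrite ler_wpM2l ?addr_ge0.
have : 0 <= p.+1%:R * x ^+ p * d * d by rewrite !mulr_ge0 ?exprn_ge0.
rewrite -[p.+2%:R]natr1 !exprS; set a := x ^+ p; set b := _%:R; nra.
Qed.

(** The third term is kept because, in the recurrence for [nvprod], it pays for the summand with one
    cycle fewer. *)
Lemma exprD1_ge x p : 0 <= x ->
  x ^+ p.+2 + p.+2%:R * x ^+ p.+1 + x ^+ p <= (x + 1) ^+ p.+2.
Proof.
move=> x0; have := exprD_ge p x0 ler01; rewrite mulr1 => e.
rewrite [leRHS]exprS.
apply: le_trans (_ : (x + 1) * (x ^+ p.+1 + p.+1%:R * x ^+ p) <= _); last first.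
  by rewrite ler_wpM2l ?addr_ge0.
have : 0 <= p%:R * x ^+ p by rewrite mulr_ge0 ?exprn_ge0.
rewrite -[p.+2%:R]natr1 -!natr1 !exprS; set a := x ^+ p; set b := _%:R; nra.
Qed.

Lemma exprD_le x d p : 0 <= x -> 0 <= d ->
  (x + d) ^+ p.+1 <= x ^+ p.+1 + p.+1%:R * (x + d) ^+ p * d.
Proof.
move=> x0 d0; elim: p => [|p IH]; first by rewrite expr0 !expr1; lra.
rewrite [leLHS]exprS mulrDl.
apply: le_trans (_ : x * (x ^+ p.+1 + p.+1%:R * (x + d) ^+ p * d) + d * (x + d) ^+ p.+1 <= _).
  by rewrite lerD2r ler_wpM2l.
have : 0 <= p.+1%:R * (x + d) ^+ p * d * d by rewrite !mulr_ge0 ?exprn_ge0 ?addr_ge0.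
rewrite -[p.+2%:R]natr1 !exprS; set a := (x + d) ^+ p; set b := _%:R; nra.
Qed.

(* The suffix convention for [nstirling], [nwprod] and [nvprod]: permutations of [n.+1] points
   with [p.+1] cycles, divided by [n!]. *)
Definition nstirling n p : R := stirling R n.+1 p.+1 / n`!%:R.

Lemma nstirling0 n : nstirling n 0 = 1.
Proof.
elim: n => [|n IH].
  by rewrite /nstirling stirlingS /stirling !cycle_sum_nil /= mul0r addr0 !mul1r invr1.
rewrite -IH /nstirling stirlingS {1}/stirling cycle_sum0 add0r factS natrM.
by rewrite invfM mulrACA mulfV ?mul1r // pnatr_eq0.
Qed.

Lemma nstirling0S p : nstirling 0 p.+1 = 0.
Proof.
by rewrite /nstirling stirlingS /stirling !cycle_sum_nil /= !mul0r add0r mul0r.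
Qed.

Lemma nstirlingS n p : nstirling n.+1 p.+1 = nstirling n p.+1 + nstirling n p / n.+1%:R.
Proof.
rewrite /nstirling stirlingS factS natrM.
have : n.+1%:R != 0 :> R by rewrite pnatr_eq0.
have : n`!%:R != 0 :> R by rewrite pnatr_eq0 -lt0n fact_gt0.
by move: (n`!%:R) (n.+1%:R) => a b a0 b0; field; rewrite a0 b0.
Qed.

(** By its recurrence [nstirling n p] is the elementary symmetric polynomial of degree p in 1, 1/2,
    ..., 1/n; the power of the sum contains each of its monomials p! times. *)
Lemma nstirling_le n p : nstirling n p * p`!%:R <= harm n ^+ p.
Proof.
elim: n p => [|n IH] [|p]; rewrite ?nstirling0 ?expr0 ?mulr1 //.
  by rewrite nstirling0S mul0r exprn_ge0 ?harm_ge0.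
have := exprD_ge p (harm_ge0 n) (_ : 0 <= n.+1%:R^-1); rewrite invr_ge0 harmS => /(_ (ler0n _ _)).
apply: le_trans; rewrite nstirlingS mulrDl; apply: lerD => //.
have -> : nstirling n p / n.+1%:R * p.+1`!%:R = p.+1%:R * (nstirling n p * p`!%:R) / n.+1%:R.
  by rewrite factS natrM; ring.
by rewrite ler_wpM2r ?invr_ge0 // ler_wpM2l.
Qed.

(** This is the induction step for [nstirling_ge], with [d] the new reciprocal. Truncating at 0
    keeps the claim valid while [h] is still small. *)
Lemma truncated_powS h d p : 0 <= d <= 1 ->
  Num.max 0 (h + d - p.+1%:R) ^+ p.+1 <=
  Num.max 0 (h - p.+1%:R) ^+ p.+1 + p.+1%:R * Num.max 0 (h - p%:R) ^+ p * d.
Proof.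
move=> /andP[d0 d1].
have m0 (a : R) : 0 <= Num.max 0 a by rewrite le_max lexx.
set y := h + d - _; have [y0|y0] := lerP y 0.
  by rewrite expr0n /= addr_ge0 ?mulr_ge0 ?exprn_ge0.
(* Here [d <= 1] enters: lowering the shift from p+1 to p makes up for the increment [d]. *)
have yh : y ^+ p <= Num.max 0 (h - p%:R) ^+ p.
  apply: lerXn2r; rewrite ?nnegrE ?m0 ?(ltW y0) // le_max /y -natr1.
  by apply/orP; right; lra.
apply: le_trans (_ : Num.max 0 (h - p.+1%:R) ^+ p.+1 + p.+1%:R * y ^+ p * d <= _); last first.
  by rewrite lerD2l ler_wpM2r // ler_wpM2l.
have -> : h - p.+1%:R = y - d by rewrite /y; ring.
have [yd|dy] := lerP (y - d) 0.
  rewrite expr0n add0r exprSr -natr1 mulrDl mul1r mulrDl.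
  have : y ^+ p * y <= y ^+ p * d by rewrite ler_wpM2l ?exprn_ge0 ?(ltW y0) //; lra.
  have : 0 <= p%:R * y ^+ p * d by rewrite !mulr_ge0 ?exprn_ge0 ?(ltW y0).
  lra.
have := exprD_le p (ltW dy) d0.
by rewrite subrK.
Qed.

(** The reciprocals are at most 1, so forbidding repeated indices costs at most p in each factor of
    the power. *)
Lemma nstirling_ge n p : Num.max 0 (harm n - p%:R) ^+ p <= nstirling n p * p`!%:R.
Proof.
elim: n p => [|n IH] [|p]; rewrite ?nstirling0 ?expr0 ?mulr1 //.
  by rewrite nstirling0S mul0r /harm big_ord0 max_l ?expr0n ?sub0r ?oppr_le0.
have d01 : 0 <= (n.+1%:R^-1 : R) <= 1.
  by rewrite invr_ge0 ler0n invf_le1 ?ltr0n // ler1n.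
rewrite harmS; apply: le_trans (truncated_powS _ _ d01) _.
rewrite nstirlingS mulrDl; apply: lerD => //.
have -> : nstirling n p / n.+1%:R * p.+1`!%:R = p.+1%:R * (nstirling n p * p`!%:R) / n.+1%:R.
  by rewrite factS natrM; ring.
by rewrite ler_wpM2r ?invr_ge0 // ler_wpM2l.
Qed.

Definition nvprod n p : R := cycle_sum (@vprod R) n.+1 p.+1 / n`!%:R.

Lemma nvprod0 n : nvprod n 0 = 1.
Proof.
elim: n => [|n IH].
  rewrite /nvprod cycle_sum_vprodS !cycle_sum_nil /= /vprod /wprod !big_nil.
  by rewrite fact0 divr1; ring.
rewrite -IH /nvprod cycle_sum_vprodS !cycle_sum0 !addr0 addn0 factS natrM.
by rewrite invfM mulrACA mulfV ?mul1r // pnatr_eq0.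
Qed.

Lemma nvprod0S p : nvprod 0 p.+1 = 0.
Proof.
by rewrite /nvprod cycle_sum_vprodS !cycle_sum_nil /= /vprod !mul0r mulr0 !add0r mul0r.
Qed.

Lemma ffact_le_expn n p : (n ^_ p <= n ^ p)%N.
Proof.
by elim: p => // p IH; rewrite ffactnSr expnSr leq_mul // leq_subr.
Qed.

Lemma ffact_ge_expn n p : ((n.+1 - p) ^ p <= n ^_ p)%N.
Proof.
elim: p => // p IH; rewrite ffactnSr expnSr leq_mul ?subSS //.
by apply: leq_trans IH; case: (p) => // q; rewrite leq_exp2r // leq_sub2r.
Qed.

Definition nwprod n p : R := cycle_sum (@wprod R) n.+1 p.+1 / n`!%:R.

Lemma nwprodE n p : nwprod n p * p.+1`!%:R * p`!%:R = n.+1%:R * (n ^_ p)%:R.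
Proof.
rewrite /nwprod [_ / _ * _]mulrAC cycle_sum_wprod factS -bin_ffact !natrM.
have : n`!%:R != 0 :> R by rewrite pnatr_eq0 -lt0n fact_gt0.
by move: (n`!%:R) => a a0; field.
Qed.

Lemma nwprod_le n p : nwprod n p <= n.+1%:R ^+ p.+1.
Proof.
have w0 : 0 <= nwprod n p.
  by apply: divr_ge0 => //; apply: sumr_ge0 => s _; apply: prodr_ge0.
apply: le_trans (_ : nwprod n p * p.+1`!%:R * p`!%:R <= _).
  rewrite -mulrA ler_peMr // -natrM ler1n muln_gt0 !fact_gt0 //.
rewrite nwprodE exprS ler_wpM2l // -natrX ler_nat.
by apply: leq_trans (ffact_le_expn _ _) _; case: p {w0} => // p; rewrite leq_exp2r.
Qed.

Lemma nvprodS n p : nvprod n.+1 p.+1 =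
  ((n + p.+2)%:R * nvprod n p.+1 + nvprod n p + nwprod n p) / n.+1%:R.
Proof.
rewrite /nvprod /nwprod cycle_sum_vprodS factS natrM addSnnS.
have : n.+1%:R != 0 :> R by rewrite pnatr_eq0.
have : n`!%:R != 0 :> R by rewrite pnatr_eq0 -lt0n fact_gt0.
by move: (n`!%:R) (n.+1%:R) => a b a0 b0; field; rewrite a0 b0.
Qed.

(** In the induction the increment 1/(n+1) of [harm] absorbs the summand [nwprod n p], and the
    growth of the power absorbs the rest. *)
Lemma nvprod_le n p : nvprod n p <= n.+1%:R ^+ p * (1 + harm n).
Proof.
elim: n p => [|n IH] p.
  case: p => [|p]; first by rewrite nvprod0 expr0 mul1r lerDl harm_ge0.
  by rewrite nvprod0S mulr_ge0 ?exprn_ge0 ?addr_ge0 ?harm_ge0.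
have [-> | ] := eqVneq p 0%N; first by rewrite nvprod0 expr0 mul1r lerDl harm_ge0.
case: p => // p _; rewrite nvprodS harmS ler_pdivrMr ?ltr0n //.
set x := n.+1%:R : R; set h := 1 + harm n.
have x0 : 0 < x by rewrite ltr0n.
have -> : n.+2%:R = x + 1 by rewrite natr1.
have h1 : 1 <= h by rewrite lerDl harm_ge0.
have -> : (n + p.+2)%:R = x + p.+1%:R by rewrite -natrD addnS addSn.
have -> : (x + 1) ^+ p.+1 * (1 + (harm n + x^-1)) * x = (x + 1) ^+ p.+1 * (h * x + 1).
  by rewrite -mulrA; congr (_ * _); rewrite !mulrDl mulVf ?gt_eqF // addrA.
have w : nwprod n p <= x ^+ p.+1 by exact: nwprod_le.
have v1 : nvprod n p.+1 <= x ^+ p.+1 * h by exact: IH.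
case: p w v1 => [|p] w v1.
  by rewrite nvprod0; move: w v1; rewrite !expr1; nra.
have v0 : nvprod n p.+1 <= x ^+ p.+1 * h by exact: IH.
have e := exprD1_ge p (ltW x0).
have xp : 0 <= x ^+ p by rewrite exprn_ge0 ?ltW.
apply: le_trans (_ : (x ^+ p.+2 + p.+2%:R * x ^+ p.+1 + x ^+ p) * (h * x + 1) <= _); last first.
  by rewrite ler_wpM2r ?addr_ge0 // mulr_ge0 // ltW // (lt_le_trans ltr01).
have : (x + p.+2%:R) * nvprod n p.+2 <= (x + p.+2%:R) * (x ^+ p.+2 * h).
  by rewrite ler_wpM2l // addr_ge0 // ltW.
have : 0 <= p.+2%:R * x ^+ p.+1 by rewrite mulr_ge0 // exprn_ge0 // ltW.
move: w v0; rewrite !(exprS _ p.+1) !(exprS _ p).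
set a := x ^+ p in xp *; set b := p.+2%:R : R; lra.
Qed.

End Bounds.

(** * Comparing [invol] with products of cycle lengths *)

Lemma invol_reversals n (s : {perm 'I_n}) : invol s = #|reversals s|.
Proof.
rewrite /invol -(card_imset (f := fun t : {perm 'I_n} => (t, t * s)%g)); last by move=> t u [].
apply: eq_card => -[t u]; rewrite inE /=; apply/and3P/imsetP => [[tt uu /eqP st]|[v + [-> ->]]].
  have e : (t * s = u)%g by rewrite st mulgA (eqP tt) mul1g.
  by exists t; rewrite ?e // inE e tt uu.
by rewrite inE => /andP[vv vs]; rewrite vv vs mulgA (eqP vv) mul1g.
Qed.

Lemma size_cycle_sizes n (s : {perm 'I_n}) : size (cycle_sizes s) = ncycles s.
Proof. by rewrite size_map -cardE. Qed.

Section InvolBounds.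
Variable R : realFieldType.

Lemma wprod_cycle_sizes n (s : {perm 'I_n}) :
  wprod R (cycle_sizes s) = (\prod_(C in porbits s) #|C|)%:R.
Proof. by rewrite /wprod big_map big_enum natr_prod. Qed.

Lemma vprod_cycle_sizes n (s : {perm 'I_n}) :
  vprod R (cycle_sizes s) =
  (\sum_(C in porbits s) \prod_(D in porbits s :\ C) #|D|)%:R.
Proof.
rewrite /vprod wprod_cycle_sizes big_map big_enum natr_sum mulr_sumr.
apply: eq_bigr => C CP; rewrite (big_setD1 C CP) natrM mulrC mulKf //.
by case/imsetP: CP => x _ ->; rewrite pnatr_eq0 card_porbit_neq0.
Qed.

Lemma invol_ge n (s : {perm 'I_n.+1}) : wprod R (cycle_sizes s) <= (invol s)%:R.
Proof. by rewrite wprod_cycle_sizes ler_nat invol_reversals (card_reversals_ge s ord0). Qed.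

Lemma invol_le n (s : {perm 'I_n.+1}) :
  (invol s)%:R <= wprod R (cycle_sizes s) +
     (ncycles s ^ ncycles s)%:R * vprod R (cycle_sizes s).
Proof.
rewrite wprod_cycle_sizes vprod_cycle_sizes -natrM -natrD ler_nat invol_reversals.
by rewrite big_distrr /=; exact: card_reversals_le ord0.
Qed.

Definition invol_sum n m : R := \sum_(s : {perm 'I_n} | ncycles s == m) (invol s)%:R.

Lemma invol_sum_ge n m : cycle_sum (@wprod R) n.+1 m <= invol_sum n.+1 m.
Proof.
rewrite /cycle_sum (eq_bigl _ _ (fun s => congr1 (eq_op^~ m) (size_cycle_sizes s))).
by apply: ler_sum => s _; exact: invol_ge.
Qed.

Lemma invol_sum_le n m : invol_sum n.+1 m <=
  cycle_sum (@wprod R) n.+1 m + (m ^ m)%:R * cycle_sum (@vprod R) n.+1 m.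
Proof.
rewrite -cycle_sumZ -cycle_sumD.
rewrite /cycle_sum (eq_bigl _ _ (fun s => congr1 (eq_op^~ m) (size_cycle_sizes s))).
by apply: ler_sum => s /eqP <-; exact: invol_le.
Qed.

End InvolBounds.

Lemma cond_involE (R : realType) (theta : R) n m : 0 < theta ->
  cond_invol theta n m = invol_sum R n m / stirling R n m.
Proof.
move=> t0; rewrite /cond_invol.
have r0 : 0 < rising theta n by rewrite /rising prodr_gt0 // => i _; rewrite ltr_wpDr.
set c := theta ^+ m / rising theta n.
have c0 : c != 0 by rewrite mulf_neq0 ?invr_eq0 ?expf_neq0 ?gt_eqF.
have e (s : {perm 'I_n}) : ncycles s == m -> ewens theta s = c by move=> /eqP sm; rewrite /ewens sm.
rewrite (eq_bigr (fun s => (invol s)%:R * c)); last by move=> s /e ->.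
rewrite [X in _ / X](eq_bigr (fun=> 1 * c)); last by move=> s /e ->; rewrite mul1r.
rewrite -!mulr_suml -mulf_div divff // mulr1; congr (_ / _).
by apply: eq_bigl => s; rewrite size_cycle_sizes.
Qed.

(** * Logarithms and harmonic sums *)

Section Logarithm.
Variable R : realType.

Lemma ln_le_subr1 (x : R) : 0 < x -> ln x <= x - 1.
Proof.
by move=> x0; have := @le_ln1Dx R (x - 1); rewrite [1 + _]addrC subrK; apply; lra.
Qed.

Lemma ln_le_harm n : ln n.+1%:R <= harm R n.
Proof.
elim: n => [|n IH]; first by rewrite ln1 /harm big_ord0.
rewrite harmS; have := ln_le_subr1 (_ : 0 < n.+2%:R / n.+1%:R :> R).
rewrite divr_gt0 // => /(_ isT); rewrite ln_div ?posrE //.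
have -> : n.+2%:R / n.+1%:R - 1 = n.+1%:R^-1 :> R.
  by rewrite -natr1 mulrDl divff ?pnatr_eq0 // mul1r addrC addKr.
move: IH; set h : R := harm R n; set i := _^-1; lra.
Qed.

Lemma harm_le_ln n : harm R n <= 1 + ln n.+1%:R.
Proof.
(* The strengthening subtracts exactly the term that the next harmonic sum adds. *)
suff : harm R n <= 1 + ln n.+1%:R - n.+1%:R^-1.
  by move=> /le_trans; apply; rewrite gerBl invr_ge0.
elim: n => [|n IH]; first by rewrite ln1 /harm big_ord0 invr1 addr0 subrr.
rewrite harmS; have := ln_le_subr1 (_ : 0 < n.+1%:R / n.+2%:R :> R).
rewrite divr_gt0 // => /(_ isT); rewrite ln_div ?posrE //.
have -> : n.+1%:R / n.+2%:R - 1 = - n.+2%:R^-1 :> R.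
  have : n.+1%:R + 1 != 0 :> R by rewrite natr1 pnatr_eq0.
  by rewrite -[n.+2%:R]natr1; move: (n.+1%:R) => x x0; field.
by move: IH; set h : R := harm R n; set i := n.+1%:R^-1; set j := n.+2%:R^-1; lra.
Qed.

(** A truncated exponential series at [ln x]. It turns the saving of order log n / n for V into one
    of order 1 / log n. *)
Lemma ln_sqr_le (x : R) : 1 <= x -> 1 + ln x ^+ 2 / 2 <= x.
Proof.
move=> x1; have := expR_ge1Dxn 1 (ln_ge0 x1).
by rewrite lnK // posrE (lt_le_trans ltr01).
Qed.

End Logarithm.

(** * Normalised counts with explicit error constants *)

Section Estimates.
Variable R : realType.
Implicit Types (n p : nat).

Lemma onemX_ge (d : R) p : 0 <= d <= 1 -> 1 - p%:R * d <= (1 - d) ^+ p.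
Proof.
move=> /andP[d0 d1]; case: p => [|p]; first by rewrite mul0r expr0 subr0.
have := @exprD_le R (1 - d) d p; rewrite subrK !expr1n mulr1 subr_ge0 => /(_ d1 d0).
lra.
Qed.

Lemma onepX_le (d : R) p : 0 <= d <= 1 -> (1 + d) ^+ p <= 1 + (p * 2 ^ p)%:R * d.
Proof.
move=> /andP[d0 d1]; case: p => [|p]; first by rewrite mul0r expr0 addr0.
have := exprD_le p (@ler01 R) d0; rewrite expr1n => /le_trans; apply.
rewrite lerD2l ler_wpM2r // natrM ler_wpM2l // natrX.
apply: le_trans (_ : 2 ^+ p <= _); last by rewrite ler_eXn2l // ltr1n.
by apply: lerXn2r; rewrite ?nnegrE; lra.
Qed.

(** With L the logarithm, [harm n] lies between L and 1 + L, so the quotient lies between (1 -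
    p/L)^p and (1 + 1/L)^p. Each end supplies one summand of the constant. *)
Lemma nstirling_ratio n p : (p%:R : R) <= ln n.+1%:R -> 1 <= ln (n.+1%:R : R) ->
  `| nstirling R n p * p`!%:R / ln n.+1%:R ^+ p - 1 | <=
    (p * p + p * 2 ^ p)%:R / ln n.+1%:R.
Proof.
have := ln_le_harm R n; have := harm_le_ln R n.
set L := ln _; set h : R := harm R n => hL Lh pL L1.
have L0 : 0 < L by lra.
have Lp0 : 0 < L ^+ p by rewrite exprn_gt0.
have e01 : 0 <= L^-1 <= 1 by rewrite invr_ge0 invf_le1 // L1 ltW.
have pe01 : 0 <= p%:R / L <= 1 by rewrite divr_ge0 ?ler_pdivrMr ?mul1r // ltW.
have lo : 1 - (p * p)%:R / L <= nstirling R n p * p`!%:R / L ^+ p.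
  have := onemX_ge p pe01; rewrite natrM mulrA => /le_trans; apply.
  have -> : 1 - p%:R / L = (L - p%:R) / L by rewrite mulrBl divff // gt_eqF.
  rewrite expr_div_n ler_wpM2r ?invr_ge0 ?(ltW Lp0) //.
  apply: le_trans (nstirling_ge _ _ _); apply: lerXn2r; rewrite ?nnegrE ?subr_ge0 //.
    by rewrite le_max lexx.
  by rewrite le_max lerD2r Lh orbT.
have up : nstirling R n p * p`!%:R / L ^+ p <= 1 + (p * 2 ^ p)%:R / L.
  apply: le_trans (onepX_le p e01).
  have -> : 1 + L^-1 = (1 + L) / L by rewrite mulrDl divff ?gt_eqF // addrC mul1r.
  rewrite expr_div_n ler_wpM2r ?invr_ge0 ?(ltW Lp0) //.
  apply: le_trans (nstirling_le _ _ _) _.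
  by apply: lerXn2r; rewrite ?nnegrE ?harm_ge0 //; lra.
have pp : 0 <= (p * p)%:R / L by rewrite divr_ge0 // ltW.
have p2 : 0 <= (p * 2 ^ p)%:R / L by rewrite divr_ge0 // ltW.
by rewrite ler_norml natrD mulrDl; apply/andP; split; lra.
Qed.

(** The summand [p * p] bounds the loss from replacing a falling factorial by a power; the other
    summand bounds the contribution of V. *)
Lemma invol_ratio n p : (p%:R : R) <= ln n.+1%:R -> 1 <= ln (n.+1%:R : R) ->
  `| invol_sum R n.+1 p.+1 / n`!%:R * p.+1`!%:R * p`!%:R / n.+1%:R ^+ p.+1 - 1 | <=
    (p * p + 4 * (p.+1 ^ p.+1 * p.+1`! * p`!))%:R / ln n.+1%:R.
Proof.
have := harm_le_ln R n.
have := ln_sublinear (_ : 0 < n.+1%:R :> R); rewrite ltr0n => /(_ isT).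
have := ln_sqr_le (_ : 1 <= n.+1%:R :> R); rewrite ler1n => /(_ isT).
set L := ln _; set h := harm R n; set x := n.+1%:R : R => Lx2 Lx hL pL L1.
have L0 : 0 < L by lra.
have x0 : 0 < x by lra.
have x1 : 0 < x ^+ p.+1 by rewrite exprn_gt0.
have pn : (p <= n.+1)%N by rewrite -(ler_nat R) -/x; lra.
set F := p.+1`!%:R * p`!%:R : R.
have F0 : 0 <= F by rewrite mulr_ge0.
set K := (p.+1 ^ p.+1)%:R : R.
have nwx : nwprod R n p * F / x ^+ p.+1 = (n ^_ p)%:R / x ^+ p.
  by rewrite mulrA nwprodE exprS; field; rewrite expf_neq0 gt_eqF.
have lo : 1 - (p * p)%:R / L <= nwprod R n p * F / x ^+ p.+1.
  have px : p%:R <= x := le_trans pL (ltW Lx).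
  have pe01 : 0 <= p%:R / x <= 1 by rewrite divr_ge0 ?ler_pdivrMr ?mul1r // ltW.
  apply: le_trans (_ : 1 - p%:R * (p%:R / x) <= _).
    by rewrite lerD2l lerN2 natrM mulrA ler_wpM2l ?mulr_ge0 // lef_pV2 ?posrE // ltW.
  rewrite nwx; apply: le_trans (onemX_ge p pe01) _.
  have -> : 1 - p%:R / x = (x - p%:R) / x by rewrite mulrBl divff // gt_eqF.
  rewrite expr_div_n ler_wpM2r ?invr_ge0 ?exprn_ge0 ?(ltW x0) //.
  by rewrite /x -natrB // -natrX ler_nat ffact_ge_expn.
have up : nwprod R n p * F / x ^+ p.+1 <= 1.
  rewrite nwx ler_pdivrMr ?exprn_gt0 // mul1r -natrX ler_nat.
  by apply: leq_trans (ffact_le_expn _ _) _; case: (p) => // q; rewrite leq_exp2r.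
have vb : nvprod R n p * F / x ^+ p.+1 <= 4 * F / L.
  apply: le_trans (_ : x ^+ p * (1 + h) * F / x ^+ p.+1 <= _).
    by rewrite ler_wpM2r ?invr_ge0 ?(ltW x1) // ler_wpM2r // nvprod_le.
  have -> : x ^+ p * (1 + h) * F / x ^+ p.+1 = F * ((1 + h) / x).
    by rewrite exprS; field; rewrite expf_neq0 gt_eqF.
  have -> : 4 * F / L = F * (4 / L) by rewrite [4 * F]mulrC mulrA.
  rewrite ler_wpM2l // ler_pdivrMr // mulrAC ler_pdivlMr //.
  (* The constant 4 arises from 2L + L^2 <= 2x + 2x, using L <= x and [ln_sqr_le]. *)
  have : (1 + h) * L <= (2 + L) * L by rewrite ler_wpM2r ?(ltW L0) //; lra.
  move: Lx2; rewrite expr2; lra.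
set A := invol_sum R n.+1 p.+1.
have Alo : nwprod R n p * F / x ^+ p.+1 <= A / n`!%:R * F / x ^+ p.+1.
  do 3![rewrite ler_wpM2r ?invr_ge0 ?(ltW x1) ?F0 //].
  exact: invol_sum_ge.
have Aup : A / n`!%:R * F / x ^+ p.+1 <=
    nwprod R n p * F / x ^+ p.+1 + K * (nvprod R n p * F / x ^+ p.+1).
  have -> : nwprod R n p * F / x ^+ p.+1 + K * (nvprod R n p * F / x ^+ p.+1) =
    (nwprod R n p + K * nvprod R n p) * F / x ^+ p.+1 by ring.
  do 2![rewrite ler_wpM2r ?invr_ge0 ?(ltW x1) ?F0 //].
  rewrite /nwprod /nvprod [K * _]mulrA -mulrDl ler_wpM2r ?invr_ge0 //.
  exact: invol_sum_le.
have KF : K * (nvprod R n p * F / x ^+ p.+1) <= 4 * (K * F) / L.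
  have -> : 4 * (K * F) / L = K * (4 * F / L) by ring.
  by rewrite ler_wpM2l.
have pp : 0 <= (p * p)%:R / L by rewrite divr_ge0 // ltW.
have kk : 0 <= 4 * (K * F) / L by rewrite !mulr_ge0 ?invr_ge0 // ltW.
rewrite -[A / _ * _ * _]mulrA -/F ler_norml natrD mulrDl.
have -> : (4 * (p.+1 ^ p.+1 * p.+1`! * p`!))%:R = 4 * (K * F).
  by rewrite natrM -mulnA natrM [(_ * p`!)%:R]natrM.
move: lo up Alo Aup KF pp kk.
set a := nwprod R n p * F / _; set b := A / _ * F / _; set c := K * _.
set d := _ / L; set e := 4 * _ / L => *.
by apply/andP; split; lra.
Qed.

End Estimates.

Theorem theorem2p2 (R : realType) (theta : R) (m : nat) :
  0 < theta -> (0 < m)%N ->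
  exists C : R, exists N : nat, forall n : nat, (N <= n)%N ->
    `| cond_invol theta n m - main_term R n m |
      <= C * (main_term R n m / ln (n%:R : R)).
Proof.
move=> t0; case: m => // p _.
pose a := (p * p + 4 * (p.+1 ^ p.+1 * p.+1`! * p`!))%:R : R.
pose b := (p * p + p * 2 ^ p)%:R : R.
have a0 : 0 <= a by [].
have b0 : 0 <= b by [].
(* Beyond this threshold the logarithm L is at least 1 + p + 2b. This gives the hypotheses of both
   ratio lemmas and b/L <= 1/2, so the normalised Stirling number is at least 1/2; its inverse is
   the factor 2 in the constant. *)
exists (2 * (a + b)); exists (Num.bound (expR (1 + p%:R + 2 * b))); case=> [|n] nN.
  move: nN; rewrite leqn0 => /eqP e.
  by have := archi_boundP (expR_ge0 (1 + p%:R + 2 * b)); rewrite e ltNge expR_ge0.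
have Lb : 1 + p%:R + 2 * b <= ln n.+1%:R.
  rewrite -ler_expR lnK ?posrE //.
  by apply: le_trans (ltW (archi_boundP (expR_ge0 _))) _; rewrite ler_nat.
have p0 : 0 <= p%:R :> R by [].
have L1 : 1 <= ln (n.+1%:R : R) by lra.
have pL : p%:R <= ln (n.+1%:R : R) by lra.
have := invol_ratio pL L1; have := nstirling_ratio pL L1.
rewrite cond_involE // /main_term -/a -/b /nstirling.
set A := invol_sum _ _ _; set S := stirling _ _ _; set L := ln _ in Lb L1 pL *.
have L0 : 0 < L by lra.
have x0 : 0 < n.+1%:R :> R by [].
have f0 k : 0 < k`!%:R :> R by rewrite ltr0n fact_gt0.
set M := _ / (_ * _).
have M0 : 0 < M by rewrite divr_gt0 ?mulr_gt0 ?exprn_gt0.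
(* Both [u] and [v] are close to 1, and the conditional expectation is [M * (v / u)], so the
   relative error is |v - u| / u. *)
set u := _ / L ^+ p; set v := _ / _ ^+ p.+1 => hu hv.
have bL : b / L <= 2^-1 by rewrite ler_pdivrMr //; lra.
have u2 : 2^-1 <= u by move: hu; rewrite ler_norml; lra.
have u0 : 0 < u by lra.
have S0 : S != 0.
  by apply: contraTneq u0; rewrite /u => ->; rewrite !mul0r ltxx.
have -> : A / S = M * (v / u).
  rewrite /M /u /v /=; field.
  by rewrite S0 !expf_neq0 ?gt_eqF.
have -> : M * (v / u) - M = M * ((v - u) / u) by field; rewrite gt_eqF.
rewrite normrM gtr0_norm // normrM normfV [`|u|]gtr0_norm //.
have -> : 2 * (a + b) * (M / L) = M * (2 * (a / L + b / L)) by ring.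
rewrite ler_wpM2l ?(ltW M0) // ler_pdivrMr //.
have : `|v - u| <= a / L + b / L.
  have -> : v - u = (v - 1) - (u - 1) by ring.
  by apply: le_trans (ler_normB _ _) _; apply: lerD.
have : 0 <= a / L + b / L by rewrite addr_ge0 ?divr_ge0 // ltW.
set c := a / L + b / L; nra.
Qed.
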